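(* Let $P,\psi_0,\dot\psi_0,u_0,\dot u_0$ be toric Cauchy data as in the context, and for $(s,x)\in\mathbb R_+\times\mathbb R^n$ let $\psi(s,x)=\psi_s(x)=(u_0+s\dot u_0)^\star(x)=\sup_{y\in P}\big(\langle x,y\rangle-u_0(y)-s\dot u_0(y)\big)$. If $x\in\Delta(\psi_s)$, then $(s,x)\in\Delta(\psi)$. That is, the singular locus of $\psi$ is the (indexed) union over $s$ of the singular loci of the functions $\psi_s$; in terms of the regular loci, $$\Delta(\psi)=\bigcup_{s\ge 0}\{s\}\times\Delta(\psi_s).$$
   Context: Toric Cauchy data. $(M,\omega)$ is a toric Kähler manifold of complex dimension $n$, with Delzant moment polytope $P=\{y\in\mathbb R^n: l_k(y)\ge 0,\ k=1,\dots,d\}$, where $l_k(y)=\langle y,v_k\rangle-\lambda_k$ are the affine functions defining the facets (inward primitive normals $v_k$; exactly $n$ facets meet at each vertex and their normals form a lattice basis). $\psi_0:\mathbb R^n\to\mathbb R$ is the open-orbit Kähler potential, in logarithmic coordinates, of an $(S^1)^n$-invariant Kähler metric in the class of $\omega$: it is smooth with positive definite Hessian, and $\nabla\psi_0$ is a diffeomorphism of $\mathbb R^n$ onto the interior $P\setminus\partial P$. $\dot\psi_0$ is the restriction to the open orbit of a smooth $(S^1)^n$-invariant function on $M$. Set $u_0:=\psi_0^\star$ (Legendre-Fenchel dual, a function on $P$) and $\dot u_0:=-\dot\psi_0\circ(\nabla\psi_0)^{-1}$, which extends to an element of $C^\infty(P)$ (smooth up to the boundary). By Guillemin, $u_0=\sum_{k=1}^d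 l_k\log l_k+F$ with $F\in C^\infty(P)$ (up to the normalization of the $l_k$), and $u_0$ is smooth with positive definite Hessian on the interior of $P$ and on the relative interior of each face. $\mathbb R_+=[0,\infty)$. For a convex function $f$, the regular locus $\Delta(f)$ is the set of points where $f$ is finite and differentiable, and the singular locus is its complement; thus $\Delta(\psi)\subset\mathbb R_+\times\mathbb R^n$ and $\Delta(\psi_s)\subset\mathbb R^n$. Differentiability of $\psi$ at a point $(0,x)$ is understood for the convex function given by the same formula for all real $s$. *)

(* Defs.v *)
(* R^n is 'rV[R]_n over an arbitrary R : realType. *)
From HB Require Import structures.
From mathcomp Require Import all_boot all_order all_algebra.
From mathcomp Require Import all_classical all_reals all_analysis.
Export numFieldNormedType.Exports.

Set Implicit Arguments.
Unset Strict Implicit.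
Unset Printing Implicit Defensive.

Import Order.TTheory GRing.Theory Num.Theory.
Local Open Scope classical_set_scope.
Local Open Scope ring_scope.

Definition dotv (R : pzRingType) (n : nat) (x y : 'rV[R]_n) : R :=
  \sum_(i < n) x 0 i * y 0 i.

(* Iterated directional derivatives of f along the vectors of vs. *)
Definition iter_derive (R : numFieldType) (V W : normedModType R)
    (vs : seq V) (f : V -> W) : V -> W :=
  foldr (fun v (g : V -> W) => ('D_v g : V -> W)) f vs.

(* C^oo on an open subset U of a finite-dimensional space: all iterated
   directional derivatives exist and are (Frechet) differentiable, hence
   continuous, at every point of U. *)
Definition smooth_on (R : numFieldType) (V W : normedModType R)
    (U : set V) (f : V -> W) : Prop :=
  forall (vs : seq V) (x : V), U x -> differentiable (iter_derive vs f) x.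

(* C^oo(A) for a closed set A, i.e. smooth up to the boundary: f agrees on A
   with a smooth function on the whole space; the values of f off A are
   irrelevant. *)
Definition smooth_upto (R : numFieldType) (V W : normedModType R)
    (A : set V) (f : V -> W) : Prop :=
  exists g : V -> W, smooth_on setT g /\ {in A, f =1 g}.

Definition grad (R : numFieldType) (n : nat) (f : 'rV[R]_n -> R)
    (x : 'rV[R]_n) : 'rV[R]_n :=
  \row_(i < n) 'D_('e_i) f x.

(* The quadratic form of the Hessian of f at x, evaluated at w. *)
Definition hess_form (R : numFieldType) (n : nat) (f : 'rV[R]_n -> R)
    (x w : 'rV[R]_n) : R :=
  'D_w ('D_w f) x.

(* f is a diffeomorphism of A onto B, A and B being open. *)
Definition diffeomorphism (R : numFieldType) (V W : normedModType R)
    (A : set V) (B : set W) (f : V -> W) : Prop :=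
  exists g : W -> V,
    [/\ smooth_on A f, smooth_on B g,
        (forall x, A x -> B (f x) /\ g (f x) = x) &
        (forall y, B y -> A (g y) /\ f (g y) = y)].

(* The Legendre-Fenchel dual of the function equal to f on A and +oo off A. *)
Definition legendre_fenchel (R : realType) (n : nat) (A : set 'rV[R]_n)
    (f : 'rV[R]_n -> R) (x : 'rV[R]_n) : \bar R :=
  ereal_sup [set (dotv x y - f y)%:E | y in A].

(* The regular locus of an extended-real-valued convex function.  As usual,
   differentiability at x presupposes finiteness near x. *)
Definition regular_locus (R : realType) (V : normedModType R)
    (f : V -> \bar R) : set V :=
  [set x | (\forall z \near x, f z \is a fin_num) /\
           differentiable (fine \o f : V -> R) x].

Section Polytope.
Variables (R : realType) (n d : nat).
Variables (v : 'I_d -> 'rV[int]_n) (lam : 'I_d -> R).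
Implicit Types (y w : 'rV[R]_n) (k : 'I_d) (I : {set 'I_d}).

Definition normal k : 'rV[R]_n := map_mx (fun m : int => m%:~R) (v k).

Definition facet_fun k y : R := dotv y (normal k) - lam k.

Definition polytope : set 'rV[R]_n := [set y | forall k, 0 <= facet_fun k y].

Definition active y : {set 'I_d} := [set k | facet_fun k y == 0].

(* The relative interior of the face of P cut out by l_k = 0, k in I (empty if
   I is not exactly the set of facets containing a face); I = set0 gives the
   interior of P. *)
Definition face_relint I : set 'rV[R]_n :=
  [set y | polytope y /\ active y = I].

Definition vertex y : Prop :=
  polytope y /\
  forall a b (t : R), polytope a -> polytope b -> 0 < t < 1 ->
    y = (1 - t) *: a + t *: b -> a = b.

Definition primitive (z : 'rV[int]_n) : Prop :=
  forall (m : int) (z' : 'rV[int]_n), z = m *: z' -> m \is a GRing.unit.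

(* The index map s enumerates the facets through the vertex y; an integer
   matrix is in unitmx iff its rows form a basis of the lattice Z^n. *)
Record delzant : Prop := Delzant {
  delzant_bounded : bounded_set polytope;
  delzant_full : face_relint finset.set0 !=set0;
  delzant_facet : forall k, face_relint [set k]%SET !=set0;
  delzant_primitive : forall k, primitive (v k);
  delzant_vertex : forall y, vertex y ->
    exists s : 'I_n -> 'I_d,
      [/\ injective s, active y = [set s i | i : 'I_n]%SET &
          (\matrix_(i < n) v (s i)) \in unitmx]
}.

(* The symplectic potential u_0; it is finite on P for toric Cauchy data. *)
Definition u0 (psi0 : 'rV[R]_n -> R) y : R := fine (legendre_fenchel setT psi0 y).

(* The torus-invariant Kaehler potential psi0 and the invariant velocity
   psidot0 on the open orbit, together with udot0, of which only the values on
   P matter.  A smooth invariant function on the toric manifold of P is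
   described by a function in C^oo(P) of the moment coordinate, and a Kaehler
   metric by Guillemin's boundary condition on the Legendre dual of psi0.
   The constant c accounts for the normalization of the logarithmic coordinates
   (c = 1 for x = log |z|^2, c = 1/2 for x = log |z|); the term l_k log l_k is 0
   where l_k = 0. *)
Record toric_cauchy_data (psi0 psidot0 udot0 : 'rV[R]_n -> R) : Prop :=
  ToricCauchyData {
  tcd_delzant : delzant;
  tcd_psi0_smooth : smooth_on setT psi0;
  tcd_psi0_hess : forall x w, w != 0 -> 0 < hess_form psi0 x w;
  tcd_psi0_grad : diffeomorphism setT (interior polytope) (grad psi0);
  tcd_psidot0_smooth : smooth_on setT psidot0;
  tcd_udot0 : forall x, udot0 (grad psi0 x) = - psidot0 x;
  tcd_udot0_smooth : smooth_upto polytope udot0;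
  tcd_guillemin : exists (c : R) (F : 'rV[R]_n -> R),
    [/\ 0 < c, smooth_upto polytope F &
        forall y, polytope y ->
          legendre_fenchel setT psi0 y =
            (c * (\sum_k facet_fun k y * ln (facet_fun k y)) + F y)%:E];
  (* Positivity of the Hessian of u_0 restricted to each (open) face, the face
     I = set0 being the interior; smoothness there follows from tcd_guillemin. *)
  tcd_face_hess : forall I y w, face_relint I y -> w != 0 ->
    (forall k, k \in I -> dotv w (normal k) = 0) ->
    0 < hess_form (u0 psi0) y w
}.

Definition psi (psi0 udot0 : 'rV[R]_n -> R) (s : R) (x : 'rV[R]_n) : \bar R :=
  legendre_fenchel polytope (fun y => u0 psi0 y + s * udot0 y) x.

Definition half_space : set (R * 'rV[R]_n) := [set p | 0 <= p.1].

(* psi is given by the same formula for all real s, which gives a meaning to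
   differentiability at s = 0. *)
Definition Delta_psi (psi0 udot0 : 'rV[R]_n -> R) : set (R * 'rV[R]_n) :=
  half_space `&`
  @regular_locus R (R * 'rV[R]_n)%type (fun p => psi psi0 udot0 p.1 p.2).

Definition Delta_psi_s (psi0 udot0 : 'rV[R]_n -> R) (s : R) : set 'rV[R]_n :=
  regular_locus (psi psi0 udot0 s).

End Polytope.

(* Main.v *)
(* The polytope P is compact and, by Guillemin's formula, u_0 is continuous on
   it, so the supremum defining psi is attained.  Every maximizer at (s, x) is a
   subgradient of psi_s at x; if psi_s is differentiable at x, it is the gradient
   there, so the maximizer is unique.  By uniqueness and compactness the
   maximizers at nearby points converge to it, and Danskin's envelope argument
   gives joint differentiability of psi at (s, x).  The converse is restriction
   to a slice. *)
Require Import Defs.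
From mathcomp Require Import all_boot all_order all_algebra.
From mathcomp Require Import all_classical all_reals all_analysis.
From mathcomp Require Import ring lra.
From HB Require Import structures.
Import Order.TTheory GRing.Theory Num.Theory.
Local Open Scope classical_set_scope.
Local Open Scope ring_scope.

(* On the whole line, because [ln t = 0] for [t <= 0]. *)
Lemma continuous_xlnx (R : realType) : continuous (fun t : R => t * ln t).
Proof.
move=> t; have [t0|t0|->] := ltgtP t 0.
- apply: cvg_near_cst; rewrite [ln t]ln0 ?(ltW t0)// mulr0.
  by apply: filterS (lt_nbhsl t0) => z z0; rewrite ln0 ?mulr0 ?ltW.
- exact: cvgM cvg_id (continuous_ln t0).
- apply/cvgrPdist_le => e e0; near=> z; rewrite mul0r sub0r normrN.
  have [z0|z0] := leP z 0; first by rewrite ln0// mulr0 normr0 ltW.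
  pose r := Num.sqrt z.
  have r0 : 0 < r by rewrite sqrtr_gt0.
  have zr : z = r ^+ 2 by rewrite sqr_sqrtr// ltW.
  have z1 : z < 1 by near: z; exact: lt_nbhsl.
  (* This threshold makes [r < e / 2], so the final bound [2 * r] is below [e]. *)
  have ze : z < (e / 2) ^+ 2.
    by near: z; apply: lt_nbhsl; rewrite exprn_gt0// divr_gt0.
  (* z = r ^ 2 and - ln r = ln (1 / r) < 1 / r give |z ln z| <= 2 r *)
  have lnr : - ln r < r^-1.
    by rewrite -lnV ?posrE// ln_sublinear// invr_gt0.
  have re : r < e / 2.
    by rewrite -(@ltr_pXn2r _ 2)// ?nnegrE ?ltW -?zr// divr_gt0.
  rewrite normrM gtr0_norm// ler0_norm; last by rewrite ln_le0// ltW.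
  rewrite zr lnXn// -mulNrn mulrnAr expr2 -mulrA.
  have : r * - ln r <= 1 by rewrite -[leRHS](@mulfV _ r) ?gt_eqF// ler_pM2l// ltW.
  nra.
Unshelve. all: by end_near. Qed.

(** * Differentiability of a maximum over a compact set *)

(** Danskin's argument. For [p] near [p0], compactness confines the maximizers to points where the
    first-order estimate by [l] holds, and the increment of [f] is then squeezed between those of
    [q] at [y0] and at a maximizer. *)
Lemma differentiable_max (R : realType) (V : normedModType R)
    (T : topologicalType) (K : set T) (f : V -> R) (q : V -> T -> R)
    (l : {linear V -> R}) (p0 : V) (y0 : T) :
  compact K -> K y0 ->
  (forall p y, K y -> q p y <= f p) ->
  (forall p, exists2 y, K y & f p = q p y) ->
  continuous (fun z : V * T => q z.1 z.2) ->
  (forall y, K y -> y <> y0 -> q p0 y < f p0) ->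
  continuous l ->
  (forall e, 0 < e -> \forall y \near y0,
     forall h, `|q (h + p0) y - q p0 y - l h| <= e * `|h|) ->
  differentiable f p0.
Proof.
move=> cK Ky0 qf fmax qc uniq lc ql.
have f0 : f p0 = q p0 y0.
  have [y Ky fy] := fmax p0; have [<-//|/(uniq _ Ky)] := pselect (y = y0).
  by rewrite fy ltxx.
suff dE : f \o shift p0 = cst (f p0) + l +o_ 0 id.
  apply/diff_locallyP; have ldE := diff_unique lc dE.
  by rewrite ldE.
apply/eqaddoP => e e0.
(* Compactness in near-covering form makes the neighbourhood of [p0] independent of [y]. Around [y0]
   the estimate holds by [ql]; around any other point the strict inequality at [p0] persists by
   joint continuity. *)
have near_max : \forall p \near p0, forall y, K y ->
    (forall h, `|q (h + p0) y - q p0 y - l h| <= e * `|h|) \/ q p y < q p y0.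
  apply: (compact_near_coveringP K).1 cK _ _ _ _ _ => // y Ky.
  have [->|yy0] := pselect (y = y0).
    by apply: filterS (@filter_prod1 _ _ _ (nbhs p0) _ _ (ql _ e0)) => z; left.
  have : q p0 y - q p0 y0 < 0 by rewrite subr_lt0 -f0; exact: uniq.
  have c : (fun z : T * V => q z.2 z.1 - q z.2 y0) @ (nbhs y, nbhs p0) -->
           q p0 y - q p0 y0.
    apply: cvgB.
      by apply: (cvg_comp (fun z : T * V => (z.2, z.1)) _ _ (qc (p0, y)));
        apply: cvg_pair; [exact: cvg_snd|exact: cvg_fst].
    by apply: (cvg_comp (fun z : T * V => (z.2, y0)) _ _ (qc (p0, y0)));
      apply: cvg_pair; [exact: cvg_snd|exact: cvg_cst].
  move=> /(cvgr_lt _ c); apply: filterS => z; rewrite subr_lt0; by right.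
have : \forall h \near 0, forall y, K y ->
    (forall h, `|q (h + p0) y - q p0 y - l h| <= e * `|h|) \/
    q (h + p0) y < q (h + p0) y0.
  move: near_max; rewrite (near_shift 0) /=.
  by apply: filterS => h; rewrite /= subr0.
apply: filterS => h hP /=.
have [y Ky fy] := fmax (h + p0).
(* A maximizer at [h + p0] cannot be beaten by [y0], so the first alternative holds. *)
have yn : `|q (h + p0) y - q p0 y - l h| <= e * `|h|.
  by have [//|] := hP y Ky; rewrite -fy ltNge qf.
have y0n := nbhs_singleton (ql _ e0) h.
(* Testing [f p0] against [y] bounds the increment from above; testing [f (h + p0)] against [y0]
   bounds it from below. *)
have := qf p0 y Ky; have := qf (h + p0) y0 Ky0.
rewrite !fctE /= f0.
move: yn y0n; rewrite !ler_norml; rewrite fy; lra.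
Qed.

(** * The pairing, subgradients and the Legendre-Fenchel dual *)

Lemma dotvD {R : pzRingType} {n} (x y z : 'rV[R]_n) :
  dotv (x + y) z = dotv x z + dotv y z.
Proof.
by rewrite /dotv -big_split/=; apply: eq_bigr => i _; rewrite mxE mulrDl.
Qed.

Lemma dotvZ {R : pzRingType} {n} a (x z : 'rV[R]_n) :
  dotv (a *: x) z = a * dotv x z.
Proof.
by rewrite /dotv mulr_sumr; apply: eq_bigr => i _; rewrite mxE mulrA.
Qed.

Lemma dotv_delta {R : pzRingType} {n} (i : 'I_n) (z : 'rV[R]_n) :
  dotv 'e_i z = z 0 i.
Proof.
rewrite /dotv (bigD1 i)//= mxE !eqxx mul1r big1 ?addr0// => j /negPf ji.
by rewrite mxE ji mul0r.
Qed.

Lemma dotv_norm_le {R : realType} {n} (x z : 'rV[R]_n) :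
  `|dotv x z| <= n%:R * `|x| * `|z|.
Proof.
apply: le_trans (ler_norm_sum _ _ _) _.
have coordle (u : 'rV[R]_n) i : `|u 0 i| <= `|u|.
  rewrite [leRHS]/Num.Def.normr/= mx_normrE.
  by apply/bigmax_geP; right; exists (0, i).
apply: (@le_trans _ _ (\sum_(i < n) `|x| * `|z|)).
  by apply: ler_sum => i _; rewrite normrM ler_pM.
by rewrite sumr_const card_ord -mulrA mulr_natl.
Qed.

Lemma continuous_dotv {R : realType} {n} {T : topologicalType}
    {f g : T -> 'rV[R]_n} :
  continuous f -> continuous g -> continuous (fun t => dotv (f t) (g t)).
Proof.
move=> fc gc t; apply: cvg_big => [|i _]; first exact: add_continuous.
have coord := @coord_continuous R 1 n 0 i.
apply: cvgM.
  exact: cvg_comp (fc t) (coord _).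
exact: cvg_comp (gc t) (coord _).
Qed.

(** Difference quotients with [t > 0] are at least [dotv h y], hence so is the derivative along [h].
    The same bound for [- h] reverses the inequality by linearity. *)
Lemma subgradient_eq {R : realType} {n} (f : 'rV[R]_n -> R) (x y : 'rV[R]_n) :
  differentiable f x -> (forall h, f x + dotv h y <= f (h + x)) ->
  forall h, 'd f x h = dotv h y.
Proof.
move=> df fy.
have le h : dotv h y <= 'd f x h.
  have c : derivable f x h by exact: diff_derivable.
  rewrite -deriveE// /derive cvg_at_rightE//.
  apply: limr_ge; first by apply/cvg_ex; eexists; exact: cvg_dnbhs_at_right c.
  near=> t.
  have t0 : 0 < t by near: t; exact: nbhs_right_gt.
  rewrite /= /GRing.scale/= -ler_pdivrMl ?invr_gt0// invrK -dotvZ.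
  by rewrite lerBrDl fy.
move=> h; apply/eqP; rewrite eq_le le andbT.
by have := le (- h); rewrite linearN -scaleN1r dotvZ mulN1r lerN2.
Unshelve. all: by end_near. Qed.

Lemma legendre_fenchel_ge {R : realType} {n} (K : set 'rV[R]_n) f x y :
  K y -> ((dotv x y - f y)%:E <= legendre_fenchel K f x)%E.
Proof. by move=> Ky; apply: ereal_sup_ubound; exists y. Qed.

Lemma legendre_fenchel_max {R : realType} {n} (K : set 'rV[R]_n) f x :
  compact K -> K !=set0 -> continuous f ->
  exists2 y, K y & legendre_fenchel K f x = (dotv x y - f y)%:E.
Proof.
move=> cK K0 fc.
have c : continuous (fun y => dotv x y - f y).
  have xc : continuous (fun y => dotv x y).
    by apply: continuous_dotv; [exact: cst_continuous|move=> y; exact: cvg_id].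
  by move=> y; exact: cvgB (xc y) (fc y).
have [y yK ymax] := compact_EVT_max K0 cK (continuous_subspaceT c).
exists y; first exact: set_mem.
apply/eqP; rewrite eq_le legendre_fenchel_ge ?andbT; last exact: set_mem.
by apply: ge_ereal_sup => _ [z Kz <-]; rewrite lee_fin ymax// mem_set.
Qed.

(** Allows [u0] and [udot0] to be replaced by functions continuous on the whole space that agree
    with them on the polytope. *)
Lemma eq_legendre_fenchel {R : realType} {n} (K : set 'rV[R]_n) f g :
  (forall y, K y -> f y = g y) -> legendre_fenchel K f = legendre_fenchel K g.
Proof.
move=> fg; apply/funext => x; congr ereal_sup.
by apply: eq_imagel => y Ky; rewrite fg.
Qed.

(** With [c = b y], this is the exact increment, under a shift of [p] by [h], of
    [dotv p.2 y - (a y + p.1 * b y)], which is affine in [p]. *)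
Definition slope {R : realType} {n} (y : 'rV[R]_n) (c : R)
    (h : R * 'rV[R]_n) : R :=
  dotv h.2 y - h.1 * c.

Lemma slope_is_linear {R : realType} {n} (y : 'rV[R]_n) (c : R) :
  linear (slope y c).
Proof. by move=> a h k; rewrite /slope/= dotvD dotvZ /GRing.scale/=; ring. Qed.

HB.instance Definition _ (R : realType) n (y : 'rV[R]_n) (c : R) :=
  GRing.isLinear.Build R (R * 'rV[R]_n)%type R _ (slope y c)
    (slope_is_linear y c).

Lemma slope_continuous {R : realType} {n} (y : 'rV[R]_n) (c : R) :
  continuous (slope y c).
Proof.
have dc : continuous (fun h : R * 'rV[R]_n => dotv h.2 y).
  by apply: continuous_dotv; [case=> s x; exact: cvg_snd|exact: cst_continuous].
by move=> [s x]; exact: cvgB (dc _) (cvgM cvg_fst (cvg_cst c)).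
Qed.

Lemma slopeB {R : realType} {n} (y z : 'rV[R]_n) (c d : R) h :
  slope y c h - slope z d h = slope (y - z) (c - d) h.
Proof.
have -> : slope (y - z) (c - d) h = dotv h.2 y - dotv h.2 z - h.1 * (c - d).
  rewrite /slope /dotv -sumrB; congr (_ - _); apply: eq_bigr => i _.
  by rewrite !mxE mulrBr.
by rewrite /slope; ring.
Qed.

Lemma slope_norm_le {R : realType} {n} (y : 'rV[R]_n) (c : R) h :
  `|slope y c h| <= (n%:R * `|y| + `|c|) * `|h|.
Proof.
have h1 : `|h.1| <= `|h| by rewrite prod_normE le_max lexx.
have h2 : `|h.2| <= `|h| by rewrite prod_normE le_max lexx orbT.
apply: le_trans (ler_normB _ _) _; rewrite mulrDl lerD//.
  apply: le_trans (dotv_norm_le _ _) _.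
  by rewrite -mulrA [_ * `|y|]mulrC mulrA ler_wpM2l// mulr_ge0.
by rewrite normrM mulrC ler_wpM2l.
Qed.

Lemma legendre_fenchel_regular_locus {R : realType} {n} (K : set 'rV[R]_n)
    (a b : 'rV[R]_n -> R) s x :
  compact K -> K !=set0 -> continuous a -> continuous b ->
  regular_locus (legendre_fenchel K (fun y => a y + s * b y)) x ->
  regular_locus (fun p : R * 'rV[R]_n =>
    legendre_fenchel K (fun y => a y + p.1 * b y) p.2) (s, x).
Proof.
move=> cK K0 ac bc [_ dx].
pose q (p : R * 'rV[R]_n) y := dotv p.2 y - (a y + p.1 * b y).
pose phi (p : R * 'rV[R]_n) := legendre_fenchel K (fun y => a y + p.1 * b y) p.2.
have pmax p : exists2 y, K y & phi p = (q p y)%:E.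
  apply: legendre_fenchel_max => // y.
  exact: cvgD (ac y) (cvgM (@cst_continuous 'rV[R]_n R p.1 y) (bc y)).
have pfin p : phi p \is a fin_num by have [y _ ->] := pmax p.
have qle p y : K y -> q p y <= fine (phi p).
  by move=> Ky; rewrite -lee_fin fineK//; exact: legendre_fenchel_ge.
split; first by near=> p; exact: pfin.
have [y0 Ky0 phi0] := pmax (s, x).
(* A maximizer at [(s, x)] competes at [(s, h + x)] too, which makes it a subgradient of the slice;
   so it represents the differential at [x]. *)
have sub y : K y -> q (s, x) y = fine (phi (s, x)) ->
    forall h, 'd (fun x => fine (phi (s, x))) x h = dotv h y.
  move=> Ky qy; apply: subgradient_eq => // h; rewrite -qy.
  by apply: le_trans (qle (s, h + x) _ Ky); rewrite /q/= dotvD; lra.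
apply: (@differentiable_max _ _ _ K _ q (slope y0 (b y0)) _ y0) => //.
- move=> p; have [y Ky py] := pmax p; exists y => //.
  by rewrite -[LHS]/(fine (phi p)) py.
- have fstc : continuous (fun w : (R * 'rV[R]_n) * 'rV[R]_n => w.1.1).
    by case=> -[t z] y; exact: cvg_comp cvg_fst cvg_fst.
  have midc : continuous (fun w : (R * 'rV[R]_n) * 'rV[R]_n => w.1.2).
    by case=> -[t z] y; exact: cvg_comp cvg_fst cvg_snd.
  have sndc : continuous (fun w : (R * 'rV[R]_n) * 'rV[R]_n => w.2).
    by case=> p y; exact: cvg_snd.
  have lift (g : 'rV[R]_n -> R) : continuous g ->
      continuous (fun w : (R * 'rV[R]_n) * 'rV[R]_n => g w.2).
    by move=> gc w; exact: cvg_comp (sndc w) (gc w.2).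
  have dc := continuous_dotv midc sndc.
  move=> w.
  exact: cvgB (dc w) (cvgD (lift _ ac w) (cvgM (fstc w) (lift _ bc w))).
- move=> y Ky yy0; rewrite lt_neqAle qle// andbT; apply/eqP => qy; apply: yy0.
  (* Both maximizers represent one differential, so evaluating it on the basis vectors identifies
     their coordinates. *)
  apply/rowP => i; rewrite -!dotv_delta -!sub//.
  by rewrite phi0.
- exact: slope_continuous.
- move=> e e0.
  (* The factor from [slope_norm_le] for the difference of the slopes at [y] and [y0]; it does not
     depend on [h], hence the uniformity. *)
  have c0 : (fun y => n%:R * `|y - y0| + `|b y - b y0|) @ y0 --> (0 : R).
    have yc : (fun y => y - y0) @ y0 --> (0 : 'rV[R]_n).
      by apply/(@subr_cvg0 _ _ _ (nbhs y0) _ id).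
    have b0 : (fun y => b y - b y0) @ y0 --> (0 : R).
      by apply/(@subr_cvg0 _ _ _ (nbhs y0) _ b); exact: bc.
    have t1 := cvgD (cvgMl_tmp (a := n%:R) (cvg_norm yc)) (cvg_norm b0).
    by move: t1; rewrite !normr0 mulr0 addr0; apply.
  apply: filterS (cvgr_le _ c0 _ e0) => y ye h.
  have -> : q (h + (s, x)) y - q (s, x) y = slope y (b y) h.
    by rewrite /q /slope/= dotvD; ring.
  by rewrite slopeB (le_trans (slope_norm_le _ _ _))// ler_wpM2r.
Unshelve. all: by end_near. Qed.

(** * Compactness of the polytope and continuity of the data on it *)

Lemma continuous_facet_fun {R : realType} {n d} (v : 'I_d -> 'rV[int]_n)
    (lam : 'I_d -> R) k : continuous (facet_fun v lam k).
Proof.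
have dc : continuous (fun y : 'rV[R]_n => dotv y (normal R v k)).
  by apply: continuous_dotv; [move=> y; exact: cvg_id|exact: cst_continuous].
by move=> y; exact: cvgB (dc y) (cvg_cst _).
Qed.

Lemma polytope_compact {R : realType} {n d} {v : 'I_d -> 'rV[int]_n}
    {lam : 'I_d -> R} :
  bounded_set (polytope v lam) -> compact (polytope v lam).
Proof.
move=> bP; apply: bounded_closed_compact => //.
have -> : polytope v lam = \bigcap_k (facet_fun v lam k @^-1` [set x | 0 <= x]).
  by apply/seteqP; split=> y Py k; [move=> _|]; exact: Py.
apply: closed_bigI => k _; apply: preimage_closed; last exact: closed_ge.
by move=> y _; exact: continuous_facet_fun.
Qed.

Lemma smooth_upto_continuous {R : numFieldType} {V W : normedModType R}
    {A : set V} {f : V -> W} :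
  smooth_upto A f ->
  exists2 g : V -> W, continuous g & forall x, A x -> f x = g x.
Proof.
move=> [g [sg fg]]; exists g; last by move=> x Ax; apply: fg; rewrite inE.
(* The empty list of directions gives differentiability of [g] itself. *)
by move=> x; apply: differentiable_continuous; exact: (sg [::] x I).
Qed.

(** In Guillemin's formula each term [l_k log l_k] is continuous across the facets, where [l_k]
    vanishes, and [F] is replaced by its smooth extension. *)
Lemma symplectic_potential_continuous {R : realType} {n d}
    {v : 'I_d -> 'rV[int]_n} {lam : 'I_d -> R}
    {psi0 psidot0 udot0 : 'rV[R]_n -> R} :
  toric_cauchy_data v lam psi0 psidot0 udot0 ->
  exists2 a, continuous a & forall y, polytope v lam y -> u0 psi0 y = a y.
Proof.
move=> /tcd_guillemin[c [F [_ /smooth_upto_continuous[g gc Fg] u0E]]].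
pose E y := \sum_k facet_fun v lam k y * ln (facet_fun v lam k y).
exists (fun y => c * E y + g y); last by move=> y Py; rewrite /u0 u0E// Fg.
have Ec : continuous E.
  move=> y; apply: (@cvg_big R _ _ _ _ add_continuous _ (nbhs y)) => k _.
  exact: cvg_comp (@continuous_facet_fun _ _ _ v lam k y) (@continuous_xlnx R _).
by move=> y; exact: cvgD (cvgMl_tmp (a := c) (Ec y)) (gc y).
Qed.

Theorem proposition2 (R : realType) (n d : nat)
    (v : 'I_d -> 'rV[int]_n) (lam : 'I_d -> R)
    (psi0 psidot0 udot0 : 'rV[R]_n -> R) :
  toric_cauchy_data v lam psi0 psidot0 udot0 ->
  [/\ (forall (s : R) (x : 'rV[R]_n), 0 <= s ->
         Delta_psi_s v lam psi0 udot0 s x -> Delta_psi v lam psi0 udot0 (s, x)),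
      half_space (n := n) `\` Delta_psi v lam psi0 udot0 =
        \bigcup_(s in [set s : R | 0 <= s])
          ([set s] `*` ~` Delta_psi_s v lam psi0 udot0 s) &
      Delta_psi v lam psi0 udot0 =
        \bigcup_(s in [set s : R | 0 <= s])
          ([set s] `*` Delta_psi_s v lam psi0 udot0 s)].
Proof.
move=> tcd.
have [a ac u0a] := symplectic_potential_continuous tcd.
have [b bc udot0b] := smooth_upto_continuous (tcd_udot0_smooth tcd).
have [bP [y0 [Py0 _]] _ _ _] := tcd_delzant tcd.
have cP := polytope_compact bP.
have P0 : polytope v lam !=set0 by exists y0.
have psiE : psi v lam psi0 udot0 =
    fun s => legendre_fenchel (polytope v lam) (fun y => a y + s * b y).
  apply/funext => s; apply: eq_legendre_fenchel => y Py.
  by rewrite u0a// udot0b.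
have fwd s x : 0 <= s ->
    Delta_psi_s v lam psi0 udot0 s x -> Delta_psi v lam psi0 udot0 (s, x).
  move=> s0; rewrite /Delta_psi_s /Delta_psi psiE => rx; split => //.
  (* That lemma covers every real [s], so at [s = 0] it gives differentiability from both sides. *)
  exact: legendre_fenchel_regular_locus.
have bwd s x :
    Delta_psi v lam psi0 udot0 (s, x) -> Delta_psi_s v lam psi0 udot0 s x.
  move=> [_ [fin dpsi]].
  (* Finiteness near the point and differentiability both pull back along the slice [z] to
     [(s, z)]. *)
  have dpair : differentiable (fun z : 'rV[R]_n => (s, z)) x.
    exact: differentiable_pair.
  split.
    exact: differentiable_continuous dpair _ fin.
  exact: (@differentiable_comp _ _ _ _ (fun z => (s, z))
    (fun p => fine (psi v lam psi0 udot0 p.1 p.2))).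
split => //.
- apply/seteqP; split => [[s x] [/= s0 nx]|[s x] [t /= t0 [/= -> nx]]].
    by exists s => //; split => //= rx; apply: nx; exact: fwd.
  by split => //= rx; apply: nx; exact: bwd.
- apply/seteqP; split => [[s x] rx|[s x] [t /= t0 [/= -> rx]]]; last exact: fwd.
  by exists s; [exact: rx.1|split => //=; exact: bwd].
Qed.
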